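(* Let $w$ be a finite 2D word over a finite alphabet $\Sigma$. Every 2D palindromic factor of $w$ is an HV-palindrome if and only if $w$ has no factor of the form $$\begin{pmatrix} x & u & y\\ v & p & v^R\\ y & u^R & x\end{pmatrix}$$ where $x,y\in\Sigma$ with $x\neq y$, $u$ is a row (1D word) of some length $k\ge 0$, $v$ is a column of some height $l\ge 0$, and $p$ is a 2D palindrome of size $(l,k)$.
   Context: A 2D word of size $(m,n)$ over $\Sigma$ is an $m\times n$ array $w=[w_{i,j}]$ with entries in $\Sigma$; its rows and columns are 1D words. A factor of $w$ is a sub-array $[w_{i,j}]_{a\le i\le b,\,c\le j\le d}$ of consecutive rows and columns. A 1D word is a palindrome if it equals its reversal. The reverse of a 2D word $w$ of size $(m,n)$ is $w^R=[w_{m-i+1,\,n-j+1}]_{i,j}$ (for a row or column this is the usual reversal), and $w$ is a 2D palindrome if $w=w^R$. $w$ is an HV-palindrome if all its rows and columns are 1D palindromes. In the displayed block array, blocks are placed side by side and on top of each other; when $k=0$ the blocks $u,u^R$ and $p$ are absent, and when $l=0$ the middle block row $(v\ p\ v^R)$ is absent. *)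

(* Defs.v *)
From mathcomp Require Import all_boot all_algebra.

Set Implicit Arguments.
Unset Strict Implicit.
Unset Printing Implicit Defensive.

(* A 2D word of size (m, n) over T is a matrix 'M[T]_(m, n), with indices
   starting from 0; 1D words are the rows 'rV[T]_n and the columns 'cV[T]_m. *)

(* On a row or a column, rev_ord on the index in 'I_1 is the identity, so this
   is the usual reversal of 1D words. *)
Definition word2_rev (T : Type) (m n : nat) (w : 'M[T]_(m, n)) : 'M[T]_(m, n) :=
  \matrix_(i < m, j < n) w (rev_ord i) (rev_ord j).

Definition palindrome2 (T : Type) (m n : nat) (w : 'M[T]_(m, n)) : Prop :=
  w = word2_rev w.

Definition hv_palindrome (T : Type) (m n : nat) (w : 'M[T]_(m, n)) : Prop :=
  (forall i : 'I_m, palindrome2 (row i w)) /\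
  (forall j : 'I_n, palindrome2 (col j w)).

(* The functions r and s record that the rows a, ..., a + m' - 1 and the
   columns c, ..., c + n' - 1 exist in w.  Empty factors (m' = 0 or n' = 0) are
   allowed. *)
Definition factor2 (T : Type) (m' n' m n : nat)
    (f : 'M[T]_(m', n')) (w : 'M[T]_(m, n)) : Prop :=
  exists (a c : nat) (r : 'I_m' -> 'I_m) (s : 'I_n' -> 'I_n),
    [/\ forall i : 'I_m', nat_of_ord (r i) = a + i,
        forall j : 'I_n', nat_of_ord (s j) = c + j &
        f = mxsub r s w].

(*  x   u   y
    v   p  v^R
    y  u^R  x   *)
Definition corner_block (T : Type) (k l : nat) (x y : T)
    (u : 'rV[T]_k) (v : 'cV[T]_l) (p : 'M[T]_(l, k)) :
    'M[T]_(1 + (l + 1), 1 + (k + 1)) :=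
  let sq (z : T) : 'M[T]_(1, 1) := const_mx z in
  col_mx (row_mx (sq x) (row_mx u (sq y)))
    (col_mx (row_mx v (row_mx p (word2_rev v)))
            (row_mx (sq y) (row_mx (word2_rev u) (sq x)))).

(* Main.v *)
Require Import Defs.
From mathcomp Require Import all_boot all_algebra.
From mathcomp Require Import zify.

Set Implicit Arguments.
Unset Strict Implicit.
Unset Printing Implicit Defensive.

(** If [f] is a 2D palindrome and [f i j], [f i (rev j)] differ, then neither [i]
    nor [j] is fixed by reversal, and the factor of [f] spanned by the rows [i],
    [rev i] and the columns [j], [rev j] is concentric with [f].  Hence it is again
    a 2D palindrome, and its four corners are [x, y, y, x] with [x <> y], which is
    the forbidden shape.  As [f i (rev j) = f (rev i) j], a column which is not a
    palindrome gives the same situation.  Conversely the forbidden shape is a 2D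
    palindrome whose first row is not a palindrome. *)

Definition ofirst {k : nat} : 'I_(1 + (k + 1)) := lshift (k + 1) ord0.
Definition omid {k : nat} (i : 'I_k) : 'I_(1 + (k + 1)) := rshift 1 (lshift 1 i).
Definition olast {k : nat} : 'I_(1 + (k + 1)) := rshift 1 (rshift k ord0).

(** Case analysis through this view puts an index in one of the three forms on which [corner_blockE]
    and [rev_framed] rewrite. *)
Variant framed_ord_spec (k : nat) : 'I_(1 + (k + 1)) -> Type :=
  | FramedFirst : framed_ord_spec ofirst
  | FramedMid (i : 'I_k) : framed_ord_spec (omid i)
  | FramedLast : framed_ord_spec olast.

Lemma framed_ordP (k : nat) (i : 'I_(1 + (k + 1))) : framed_ord_spec i.
Proof.
case: (split_ordP i) => [i0|i1] ->; first by rewrite ord1; constructor.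
by case: (split_ordP i1) => [i2|i2] ->; rewrite ?(ord1 i2); constructor.
Qed.

Lemma rev_ofirst (k : nat) : rev_ord (@ofirst k) = olast.
Proof. by apply: val_inj => /=; lia. Qed.

Lemma rev_olast (k : nat) : rev_ord (@olast k) = ofirst.
Proof. by apply: val_inj => /=; lia. Qed.

Lemma rev_omid (k : nat) (i : 'I_k) : rev_ord (omid i) = omid (rev_ord i).
Proof. by apply: val_inj => /=; have := ltn_ord i; lia. Qed.

Definition rev_framed := (rev_ofirst, rev_olast, rev_omid).

Section CornerBlock.

Variables (T : Type) (k l : nat).

Section Entries.

Variables (x y : T) (u : 'rV[T]_k) (v : 'cV[T]_l) (p : 'M[T]_(l, k)).

Let B := corner_block x y u v p.

Lemma corner_blockE :
  ((B ofirst ofirst = x) * (B ofirst olast = y) *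
   (B olast ofirst = y) * (B olast olast = x) *
   (forall j, B ofirst (omid j) = u ord0 j) *
   (forall j, B olast (omid j) = u ord0 (rev_ord j)) *
   (forall i, B (omid i) ofirst = v i ord0) *
   (forall i, B (omid i) olast = v (rev_ord i) ord0) *
   (forall i j, B (omid i) (omid j) = p i j))%type.
Proof.
by do !split=> *; rewrite /B /corner_block /ofirst /omid /olast
  ?(col_mxEu, col_mxEd, row_mxEl, row_mxEr, mxE) // ?[rev_ord ord0]ord1.
Qed.

Lemma corner_block_palindrome : palindrome2 p -> palindrome2 B.
Proof.
move=> pP; apply/matrixP => i j; rewrite [RHS]mxE.
case: (framed_ordP i) => [|a|]; case: (framed_ordP j) => [|b|];
  rewrite !rev_framed !corner_blockE ?rev_ordK //.
by rewrite {1}pP mxE.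
Qed.

End Entries.

(** Reversal maps the last row to the first row and the last column to the first column, so these
    borders and the centre determine [B]. *)
Lemma palindrome_corner_block (B : 'M[T]_(1 + (l + 1), 1 + (k + 1))) :
  palindrome2 B ->
  exists (u : 'rV[T]_k) (v : 'cV[T]_l) (p : 'M[T]_(l, k)),
    palindrome2 p /\
    B = corner_block (B ofirst ofirst) (B ofirst olast) u v p.
Proof.
move=> BP; have BE i j : B i j = B (rev_ord i) (rev_ord j).
  by rewrite {1}BP mxE.
exists (\row_j B ofirst (omid j))%R, (\col_i B (omid i) ofirst)%R.
exists (\matrix_(i, j) B (omid i) (omid j))%R; split.
  by apply/matrixP => i j; rewrite !mxE BE !rev_omid.
apply/matrixP => i j.
case: (framed_ordP i) => [|a|]; case: (framed_ordP j) => [|b|];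
  rewrite corner_blockE ?mxE //; by rewrite BE !rev_framed.
Qed.

End CornerBlock.

Lemma factor2_mxsub (T : Type) (m1 n1 m2 n2 m n : nat) (f : 'M[T]_(m2, n2))
    (w : 'M[T]_(m, n)) (a c : nat) (r : 'I_m1 -> 'I_m2) (s : 'I_n1 -> 'I_n2) :
  (forall i, r i = a + i :> nat) -> (forall j, s j = c + j :> nat) ->
  factor2 f w -> factor2 (mxsub r s f) w.
Proof.
move=> rE sE [a' [c' [r' [s' [r'E s'E ->]]]]].
exists (a' + a), (c' + c), (r' \o r), (s' \o s); split=> [i|j|] /=.
- by rewrite r'E rE addnA.
- by rewrite s'E sE addnA.
- by apply/matrixP => i j; rewrite !mxE.
Qed.

Lemma concentric_embedding (m : nat) (i : 'I_m) : i < rev_ord i ->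
  exists (l : nat) (r : 'I_(1 + (l + 1)) -> 'I_m),
    [/\ forall a, r a = i + a :> nat,
        forall a, r (rev_ord a) = rev_ord (r a),
        r ofirst = i & r olast = rev_ord i].
Proof.
(* The interval from [i] to [m - 1 - i] has [m - i.*2] indices, at least two by [lt_i]; [l] counts
   those strictly between its ends. The default of [insubd] is never reached, as [i + a < m]. *)
move=> /= lt_i; exists (m - i.*2 - 2), (fun a => insubd i (i + a)).
have rE (a : 'I_(1 + (m - i.*2 - 2 + 1))) : insubd i (i + a) = i + a :> nat.
  by rewrite val_insubd ifT //; have := ltn_ord a; lia.
split=> // [a||]; apply: val_inj; rewrite [LHS]rE /= ?rE /=.
- by have := ltn_ord a; lia.
- by lia.
- by lia.
Qed.

Lemma palindrome_corner_factor (T : Type) (m' n' m n : nat)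
    (f : 'M[T]_(m', n')) (w : 'M[T]_(m, n)) (i : 'I_m') (j : 'I_n') :
  factor2 f w -> palindrome2 f -> f i j <> f i (rev_ord j) ->
  exists (k l : nat) (x y : T) (u : 'rV[T]_k) (v : 'cV[T]_l) (p : 'M[T]_(l, k)),
    [/\ x <> y, palindrome2 p & factor2 (corner_block x y u v p) w].
Proof.
move=> fw fP; have fE a b : f (rev_ord a) (rev_ord b) = f a b.
  by rewrite [in RHS]fP mxE.
have fE' a b : f (rev_ord a) b = f a (rev_ord b) by rewrite -fE rev_ordK.
wlog lt_j : j / j < rev_ord j => [IHj|].
  case: (ltngtP j (rev_ord j)) => [lt_j|gt_j|/val_inj eq_j] nej.
  - exact: IHj lt_j nej.
  - by apply: (IHj (rev_ord j)); rewrite rev_ordK // => /esym.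
  - by case: nej; rewrite -eq_j.
(* By [fE] and [fE'], replacing [i] by [rev_ord i] only swaps the two entries compared; if [i] is
   its own reversal, they are equal. *)
wlog lt_i : i / i < rev_ord i => [IHi|].
  case: (ltngtP i (rev_ord i)) => [lt_i|gt_i|/val_inj eq_i] nei.
  - exact: IHi lt_i nei.
  - by apply: (IHi (rev_ord i)); rewrite ?rev_ordK // fE fE' => /esym.
  - by case: nei; rewrite -fE' -eq_i.
move=> ne_xy.
have [l [r [rE rR r0 _]]] := concentric_embedding lt_i.
have [k [s [sE sR s0 s1]]] := concentric_embedding lt_j.
(* Selecting rows and columns by maps that commute with reversal preserves 2D palindromes. *)
have BP : palindrome2 (mxsub r s f).
  by apply/matrixP => a b; rewrite !mxE rR sR fE.
have [u [v [p [pP Bdef]]]] := palindrome_corner_block BP.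
exists k, l, (f i j), (f i (rev_ord j)), u, v, p; split=> //.
move: Bdef; rewrite !mxE r0 s0 s1 => <-.
exact: factor2_mxsub rE sE fw.
Qed.

Theorem theorem3p5 (Sigma : finType) (m n : nat) (w : 'M[Sigma]_(m, n)) :
  (forall (m' n' : nat) (f : 'M[Sigma]_(m', n')),
      factor2 f w -> palindrome2 f -> hv_palindrome f)
  <->
  ~ (exists (k l : nat) (x y : Sigma) (u : 'rV[Sigma]_k) (v : 'cV[Sigma]_l)
            (p : 'M[Sigma]_(l, k)),
        [/\ x <> y, palindrome2 p & factor2 (corner_block x y u v p) w]).
Proof.
split=> [HV [k [l [x [y [u [v [p [ne_xy pP Bw]]]]]]]] | noB m' n' f fw fP].
  have [rowP _] := HV _ _ _ Bw (corner_block_palindrome x y u v pP).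
  (* Comparing the two ends of the first row gives [x = y]. *)
  have /matrixP/(_ ord0 ofirst) := rowP ofirst.
  by rewrite [LHS]mxE [RHS]mxE [RHS]mxE rev_ofirst !corner_blockE.
have rev2 i j : f i j = f i (rev_ord j).
  (* Equality on [Sigma] is decidable, so a proof by contradiction is available. *)
  by apply/eqP/negPn/negP => /eqP /(palindrome_corner_factor fw fP).
split=> [i|j]; apply/matrixP => a b; rewrite !mxE //.
(* For columns, reversing both indices and then undoing the column reversal by [rev2] leaves only
   the row reversed. *)
by rewrite [in LHS]fP mxE -rev2.
Qed.
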